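(* Let $L/K$ be a finite field extension. Then $L_{dif}=L^{sep}=L^{\mathcal{D}(L/K)_+}$.
   Context: For a finite field extension $L/K$ (of arbitrary characteristic): $\mathcal{D}(L/K)=\bigcup_{i\ge0}\mathcal{D}_i\subseteq\mathrm{End}_K(L)$ is the algebra of $K$-linear differential operators on $L$, where $\mathcal{D}_0=L$ (acting by multiplication) and $\mathcal{D}_i=\{\delta\in\mathrm{End}_K(L)\mid\delta l-l\delta\in\mathcal{D}_{i-1}\text{ for all }l\in L\}$. $\mathcal{D}(L/K)_+=\{\delta\in\mathcal{D}(L/K)\mid\delta(1)=0\}$. $L_{dif}=\{l\in L\mid l\delta=\delta l\text{ for all }\delta\in\mathcal{D}(L/K)\}$ (with $l$ viewed as a multiplication operator). $L^{\mathcal{D}(L/K)_+}=\{l\in L\mid\delta(l)=0\text{ for all }\delta\in\mathcal{D}(L/K)_+\}$. $L^{sep}$ is the largest separable subfield of $L/K$. *)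

(* Defs.v *)
From HB Require Import structures.
From mathcomp Require Import all_boot all_order all_algebra all_field.
From mathcomp Require Import boolp classical_sets.

Set Implicit Arguments.
Unset Strict Implicit.
Unset Printing Implicit Defensive.

Import GRing.Theory.

Local Open Scope classical_set_scope.
Local Open Scope ring_scope.

(* [\o] is composition of K-linear maps; the ring product on ['End(L)] is the
   converse of composition and is therefore avoided. *)
Fixpoint diffop_le (K : fieldType) (L : fieldExtType K) (i : nat) :
    set 'End(L) :=
  match i with
  | 0 => [set amull l | l in [set: L]]
  | j.+1 => [set delta : 'End(L) | forall l : L,
               @diffop_le K L j ((delta \o amull l) - (amull l \o delta))%VF]
  end.
Arguments diffop_le {K} L i _.

Definition diffop (K : fieldType) (L : fieldExtType K) : set 'End(L) :=
  \bigcup_i diffop_le L i.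
Arguments diffop {K} L _.

Definition diffop_plus (K : fieldType) (L : fieldExtType K) : set 'End(L) :=
  [set delta | diffop L delta /\ delta 1 = 0].
Arguments diffop_plus {K} L _.

Definition L_dif (K : fieldType) (L : fieldExtType K) : set L :=
  [set l | forall delta : 'End(L), diffop L delta ->
             (amull l \o delta = delta \o amull l)%VF].
Arguments L_dif {K} L _.

Definition L_inv (K : fieldType) (L : fieldExtType K) : set L :=
  [set l | forall delta : 'End(L), diffop_plus L delta -> delta l = 0].
Arguments L_inv {K} L _.

(* The image of K in L is the subfield [1%AS], contained in every
   [{subfield L}]. *)
Definition L_sep (K : fieldType) (L : fieldExtType K) : {subfield L} :=
  <<1; separable_generator 1%AS {:L}>>%AS.

Lemma L_sep_separable (K : fieldType) (L : fieldExtType K) :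
  separable 1%AS (L_sep L).
Proof. by rewrite /L_sep -adjoin_separable_eq separable_generatorP. Qed.

Lemma L_sep_largest (K : fieldType) (L : fieldExtType K) (E : {subfield L}) :
  separable 1%AS E -> (E <= L_sep L)%VS.
Proof.
move=> /separableP sepE; apply/subvP => v Ev.
have /purely_inseparableP insep := separable_generator_maximal {:L} 1%AS.
rewrite -separable_inseparable_element insep ?memvf // andbT.
exact: separable_elementS (subv_adjoin _ _) (sepE v Ev).
Qed.

(* Main.v *)
(* Write [ad x phi = phi x - x phi].
   A separable element [s] commutes with every differential operator [delta], by
   induction on the order: if [s] commutes with [d = ad s delta], then
   [delta p(s) = p(s) delta + p'(s) d] for every polynomial [p] over [K], and for
   the minimal polynomial of [s] this reads [p'(s) d = 0] with [p'(s) != 0].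
   If [l] commutes with [delta] and [delta 1 = 0], then [delta l = l delta 1 = 0].
   Finally [L] is purely inseparable over [L^sep], so every [x] has a power [x^n]
   in [L^sep], with [n] a power of the characteristic exponent.  Then
   [(ad x)^n = ad (x^n)], so every [L^sep]-linear map is locally ad-nilpotent, and
   hence a differential operator.  Applied to [id - pi], with [pi] an
   [L^sep]-linear projection onto [L^sep], this shows that only elements of
   [L^sep] are killed by all differential operators killing 1. *)
From HB Require Import structures.
Require Import Defs.
From mathcomp Require Import all_boot all_order all_algebra all_field.
From mathcomp Require Import boolp classical_sets.
From mathcomp Require Import ring.

Import GRing.Theory.

Local Open Scope classical_set_scope.
Local Open Scope ring_scope.

Section DifferentialOperators.
Variables (K : fieldType) (L : fieldExtType K).
Implicit Types (x y s v : L) (phi psi delta : 'End(L)).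

Definition ad x phi : 'End(L) := ((phi \o amull x) - (amull x \o phi))%VF.

Lemma adE x phi v : ad x phi v = phi (x * v) - x * phi v.
Proof. by rewrite /ad add_lfunE opp_lfunE !comp_lfunE !lfunE. Qed.

Lemma adC x y phi : ad x (ad y phi) = ad y (ad x phi).
Proof. by apply/lfunP => v; rewrite !adE [y * (x * v)]mulrCA; ring. Qed.

(** Composition with [x] on the right and on the left commute, so the iterate is [('X - x%:P) ^+ n]
    with ['X] acting by precomposition with [x]. *)
Lemma iter_ad x n phi v :
  iter n (ad x) phi v =
    \sum_(i < n.+1) (('X - x%:P) ^+ n)`_i * phi (x ^+ i * v).
Proof.
elim: n phi v => [|n IHn] phi v.
  by rewrite big_ord1 expr0 coef1 !mul1r.
rewrite iterSr IHn (eq_bigr (fun i : 'I_n.+1 =>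
    (('X - x%:P) ^+ n)`_i * phi (x ^+ i.+1 * v)
      - x * ((('X - x%:P) ^+ n)`_i * phi (x ^+ i * v)))); last first.
  by move=> i _; rewrite adE exprS mulrA; ring.
rewrite sumrB -mulr_sumr.
under [RHS]eq_bigr => i _.
  rewrite exprSr mulrBr coefB coefMX coefMC mulrBl.
  over.
(* The factor ['X] shifts coefficients, so the first sum loses its term of index 0; the second loses
   index [n.+1], beyond the degree of [('X - x%:P) ^+ n]. *)
rewrite sumrB [X in _ = X - _]big_ord_recl /= mul0r add0r; congr (_ - _).
rewrite [RHS]big_ord_recr /= [X in X * x]nth_default ?mul0r ?addr0.
  by rewrite mulr_sumr; apply: eq_bigr => i _; rewrite mulrCA mulrA.
by rewrite size_exp_XsubC.
Qed.

(** By Frobenius only the two extreme terms of [iter_ad] survive. In characteristic 0 the hypothesis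
    forces [n = 1]. *)
Lemma iter_ad_pchar x n phi :
  [pchar L].-nat n -> iter n (ad x) phi = ad (x ^+ n) phi.
Proof.
move=> pcharLn; apply/lfunP => v; rewrite iter_ad adE.
have nX : [pchar {poly L}].-nat n.
  by rewrite (eq_pnat _ (pchar_poly L)).
have -> : ('X - x%:P) ^+ n = 'X^n - (x ^+ n)%:P.
  by rewrite exprDn_pchar // exprNn_pchar // polyC_exp.
case: n pcharLn {nX} => [|n] _ //.
rewrite big_ord_recr big_ord_recl /= big1 => [|i _].
  rewrite !coefB !coefXn !coefC eqxx /= expr0 mul1r; ring.
by rewrite coefB coefXn coefC /= eqSS ltn_eqF // subrr mul0r.
Qed.

Lemma ad_linear x : linear (ad x).
Proof.
move=> a phi psi; apply/lfunP => v.
rewrite [RHS]add_lfunE scale_lfunE !adE !add_lfunE !scale_lfunE.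
by rewrite mulrDr -scalerAr scalerBr opprD addrACA.
Qed.

Lemma ad_linearl a x y phi : ad (a *: x + y) phi = a *: ad x phi + ad y phi.
Proof.
apply/lfunP => v.
rewrite [RHS]add_lfunE scale_lfunE !adE !mulrDl linearD -!scalerAl linearZ /= scalerBr.
by rewrite opprD addrACA.
Qed.

Lemma ad_amull x y : ad x (amull y) = 0.
Proof. by apply/lfunP => v; rewrite adE zero_lfunE !lfunE /=; ring. Qed.

Lemma iter_adC x y m n phi :
  iter m (ad x) (iter n (ad y) phi) = iter n (ad y) (iter m (ad x) phi).
Proof.
elim: m => //= m ->; elim: n => //= n IHn.
by rewrite adC IHn.
Qed.

Lemma diffop_le_linear i a phi psi :
  diffop_le L i phi -> diffop_le L i psi -> diffop_le L i (a *: phi + psi).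
Proof.
elim: i phi psi => [|i IHi] phi psi /=.
  by move=> [l _ <-] [m _ <-]; exists (a *: l + m) => //; rewrite linearP.
move=> Dphi Dpsi l; have := IHi _ _ (Dphi l) (Dpsi l).
by rewrite -!/(ad _ _) ad_linear.
Qed.

Lemma diffop_le0 i : diffop_le L i 0.
Proof.
elim: i => [|i IHi] /=; first by exists 0 => //; rewrite linear0.
move=> l; rewrite -/(ad _ _); suff -> : ad l 0 = 0 by [].
by apply/lfunP => v; rewrite adE !zero_lfunE mulr0 subrr.
Qed.

Lemma diffop_leS i phi : diffop_le L i phi -> diffop_le L i.+1 phi.
Proof.
elim: i phi => [|i IHi] phi.
  by move=> [l _ <-] x; rewrite -/(ad _ _) ad_amull; apply: (diffop_le0 0).
by move=> Dphi x; apply/IHi/Dphi.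
Qed.

Lemma diffop_le_mono i j phi :
  (i <= j)%N -> diffop_le L i phi -> diffop_le L j phi.
Proof. by move=> /subnK <- Dphi; elim: (j - i)%N => // k /diffop_leS. Qed.

Lemma diffop_ad x phi : diffop L phi -> diffop L (ad x phi).
Proof. by move=> [i _ /diffop_leS Dphi]; exists i => //; apply: Dphi. Qed.

Lemma diffop_iter_ad x n phi : diffop L phi -> diffop L (iter n (ad x) phi).
Proof. by move=> Dphi; elim: n => //= n; apply: diffop_ad. Qed.

Lemma diffop_le_bound (xs : seq L) phi :
    (forall x, x \in xs -> diffop L (ad x phi)) ->
  exists i, forall x, x \in xs -> diffop_le L i (ad x phi).
Proof.
elim: xs => [|y xs IHxs] Dphi; first by exists 0%N.
have [x xs_x|i Di] := IHxs; first by apply: Dphi; rewrite inE xs_x orbT.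
have [j _ Dj] := Dphi y (mem_head _ _); exists (maxn i j) => x.
rewrite inE => /predU1P[->|/Di].
  by apply: diffop_le_mono Dj; apply: leq_maxr.
by apply: diffop_le_mono; apply: leq_maxl.
Qed.

(** The finitely many orders on a basis have a common bound, which extends to all of [L] because
    [ad] is K-linear in its first argument. *)
Lemma diffop_of_basis phi :
  (forall x, x \in vbasis {:L} -> diffop L (ad x phi)) -> diffop L phi.
Proof.
move=> /diffop_le_bound[i Di].
exists i.+1 => // x; rewrite -/(ad _ _).
rewrite (coord_vbasis (memvf x)).
elim/big_rec: _ => [|k y _ Dy].
  suff -> : ad 0 phi = 0 by apply: diffop_le0.
  by apply/lfunP => v; rewrite adE zero_lfunE !mul0r linear0 subrr.
rewrite ad_linearl; apply: diffop_le_linear => //.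
by apply: Di; apply: mem_nth; rewrite size_tuple.
Qed.

(* For each new [x], apply to [psi] the last power of [ad x] that keeps it outside
   [diffop]; the [ad x] commute, so the earlier elements are not disturbed. *)
Lemma ad_socle phi (xs : seq L) :
    (forall x, exists n, diffop L (iter n (ad x) phi)) -> ~ diffop L phi ->
  exists psi, [/\ forall x, exists n, diffop L (iter n (ad x) psi),
    ~ diffop L psi & forall x, x \in xs -> diffop L (ad x psi)].
Proof.
move=> nilphi notDphi; elim: xs => [|x xs [psi [nilpsi notDpsi Dpsi]]].
  by exists phi.
have exn : exists n, `[< diffop L (iter n (ad x) psi) >].
  by have [n Dn] := nilpsi x; exists n; apply/asboolP.
case: (ex_minnP exn) => -[/asboolP //|n] /asboolP Dn minn.
exists (iter n (ad x) psi); split.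
- move=> y; have [m Dm] := nilpsi y; exists m.
  by rewrite iter_adC; apply: diffop_iter_ad.
- by move=> /asboolP /minn; rewrite ltnn.
- move=> y; rewrite inE => /predU1P[-> //|/Dpsi Dy].
  by have /= -> := iter_adC y x 1 n psi; apply: diffop_iter_ad.
Qed.

(** Otherwise [ad_socle], run along a basis, would give an operator contradicting
    [diffop_of_basis]. *)
Lemma ad_nilpotent_diffop phi :
  (forall x, exists n, iter n (ad x) phi = 0) -> diffop L phi.
Proof.
move=> nilphi; apply: contrapT => notDphi.
have [|psi [_ notDpsi /diffop_of_basis]//] := @ad_socle phi (vbasis {:L}) _ notDphi.
move=> x; have [n nil_n] := nilphi x; exists n.
by rewrite nil_n; exists 0%N => //; apply: diffop_le0.
Qed.

Lemma diffop_purely_inseparable (S : {subfield L}) phi :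
    purely_inseparable S {:L} -> (forall s v, s \in S -> phi (s * v) = s * phi v) ->
  diffop L phi.
Proof.
move=> /purely_inseparableP insepL linphi; apply: ad_nilpotent_diffop => x.
have /purely_inseparable_elementP_pchar[n pcharLn Sxn] := insepL x (memvf x).
exists n; rewrite iter_ad_pchar //; apply/lfunP => v.
by rewrite adE linphi // subrr zero_lfunE.
Qed.

Lemma exists_linear_lker (S : {subfield L}) :
  exists phi : 'End(L), (forall s v, s \in S -> phi (s * v) = s * phi v) /\
    forall v, (phi v == 0) = (v \in S).
Proof.
(* Over the base field [S], the line spanned by 1 is [S] itself, so this projection onto [S] is
   S-linear. *)
pose pi : 'End(fieldOver S) := projv 1%VS.
pose f (v : L) : L := v - (pi v : L).
have fS s v : s \in S -> f (s * v) = s * f v.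
  move=> Ss; have /= := linearZ_LR pi (Subvs Ss) v.
  by rewrite !fieldOver_scaleE /= => piZ; rewrite /f mulrBr -piZ.
have fD u v : f (u + v) = f u + f v.
  by have piD := linearD pi u v; rewrite /f -addrACA -opprD -piD.
(* K-linearity follows from [fS], since the image of [K] lies in [S]. *)
have f_lin : linear f.
  by move=> a u v; rewrite fD -mulr_algl fS ?mulr_algl // rpredZ ?rpred1.
pose flin := GRing.isLinear.Build K L L _ f f_lin.
pose F : {linear L -> L} := HB.pack f flin.
exists (linfun F); split=> [s v Ss|v]; first by rewrite !lfunE /= fS.
rewrite lfunE /= subr_eq0 -(trivial_fieldOver v).
apply/eqP/idP => [->|/projv_id ->] //; exact: memv_proj.
Qed.

(** The Taylor expansion in [ad s] stops at first order because [ad s phi] commutes with [s]. *)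
Lemma ad_horner s phi (p : {poly K}) v :
    (forall v, ad s phi (s * v) = s * ad s phi v) ->
  phi ((map_poly (in_alg L) p).[s] * v) =
    (map_poly (in_alg L) p).[s] * phi v
      + (map_poly (in_alg L) p^`()).[s] * ad s phi v.
Proof.
move=> sd; elim/poly_ind: p v => [|p c IHp] v.
  by rewrite deriv0 !rmorph0 !horner0 !mul0r linear0 addr0.
rewrite derivD derivM derivX derivC addr0 mulr1 !rmorphD !rmorphM /=.
rewrite !map_polyX !map_polyC /= !hornerE.
rewrite mulrDl linearD /= -mulrA IHp sd mulr_algl linearZ /= adE.
by rewrite -[c *: phi v]mulr_algl; ring.
Qed.

Lemma separable_diffop_comm s phi :
  separable_element 1%AS s -> diffop L phi -> ad s phi = 0.
Proof.
move=> seps [i _]; elim: i phi => [|i IHi] phi; first by case=> l _ <-; rewrite ad_amull.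
move=> /(_ s) /IHi; rewrite -/(ad _ _) => ads0.
have sd v : ad s phi (s * v) = s * ad s phi v.
  by apply/eqP; rewrite -subr_eq0 -adE ads0 zero_lfunE.
(* The minimal polynomial is lifted to [q] over [K], whose coefficients pass through [phi]. *)
have [q Dq] := polyOver1P (minPolyOver 1%AS s).
have := separable_root_der 1%AS s; rewrite seps /root Dq.
rewrite deriv_map => /= nz.
apply/lfunP => v; rewrite zero_lfunE.
have := @ad_horner s phi q v sd.
have := root_minPoly 1%AS s; rewrite Dq => /rootP ->.
rewrite !mul0r linear0 add0r => /esym/eqP; rewrite mulf_eq0 (negPf nz) /=.
by move/eqP.
Qed.

End DifferentialOperators.

Theorem theorem3p10 (K : fieldType) (L : fieldExtType K) :
  L_dif L = [set` L_sep L] /\ [set` L_sep L] = L_inv L.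
Proof.
(* Three inclusions forming a cycle give both equalities. *)
have sep_dif : [set` L_sep L] `<=` L_dif L.
  move=> s /= Ss delta Ddelta; apply/esym/eqP; rewrite -subr_eq0; apply/eqP.
  by apply: separable_diffop_comm => //; apply: (separableP (L_sep_separable L)).
have dif_inv : L_dif L `<=` L_inv L.
  move=> l dif_l delta [Ddelta delta1].
  have /lfunP/(_ 1) := dif_l delta Ddelta.
  by rewrite !comp_lfunE !lfunE /= delta1 mulr0 mulr1.
have inv_sep : L_inv L `<=` [set` L_sep L].
  have [phi [linphi kerphi]] := exists_linear_lker K L (L_sep L).
  move=> l inv_l /=; rewrite -kerphi inv_l //; split.
    exact: diffop_purely_inseparable _ _ (separable_generator_maximal _ _) linphi.
  by apply/eqP; rewrite kerphi rpred1.
split; apply/seteqP; split=> //.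
  exact: subset_trans inv_sep.
exact: subset_trans dif_inv.
Qed.
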